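(* Let $m,n,d,e$ be positive integers with $m=2n$ and $e=\gcd(n,d)=\gcd(m,d)$, and let $s\ge v\ge1$ be integers. Then \[\sum_{i=0}^v(-1)^{v-i}4^{e\binom{v-i}{2}}\binom{v}{i}_{4^e}2^{-mi}|V_{s,i}|=2^{(e-m)v}\prod_{j=0}^{v-1}(2^{m}-4^{ej}),\] where $|V_{s,0}|=1$.
   Context: For integers $s\ge0$ and $i\ge1$, $V_{s,i}$ denotes the set of solutions $(x_1,\dots,x_{2i})\in\mathbb{F}_{2^m}^{2i}$ of the system \[\sum_{l=1}^i\big(x_{2l-1}x_{2l}^{2^{(\frac{n}{e}-j)d}}+x_{2l-1}^{2^{(\frac{n}{e}-j)d}}x_{2l}\big)=0,\qquad j=0,1,\dots,s.\] $\binom{a}{b}_q$ is the Gaussian binomial coefficient and $\binom{a}{2}=a(a-1)/2$. *)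

(* Defs.v *)
From mathcomp Require Import all_boot all_order all_algebra all_field.
Set Implicit Arguments. Unset Strict Implicit. Unset Printing Implicit Defensive.
Import Order.TTheory GRing.Theory Num.Theory.
Local Open Scope ring_scope.

(* x^{2^k} for an integer k in a field F with 2^m elements: since the
   Frobenius x |-> x^2 has order m on F_{2^m}, x^{2^k} (k possibly negative,
   meaning a power of the inverse Frobenius) equals x^{2^(k mod m)}. *)
Definition frobz (F : finFieldType) (m : nat) (k : int) (x : F) : F :=
  x ^+ (2 ^ `|(k %% m%:Z)%Z|%N)%N.

Definition coord (F : finFieldType) (N : nat) (x : {ffun 'I_N -> F}) (k : nat) : F :=
  if @insub nat (fun t => t < N)%N _ k is Some o then x o else 0.

(* V_{s,i}: solutions (x_1,...,x_{2i}) in F^{2i} of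
   sum_{l=1}^i (x_{2l-1} x_{2l}^{2^{(n/e-j)d}} + x_{2l-1}^{2^{(n/e-j)d}} x_{2l}) = 0,
   j = 0..s.  Coordinates are 0-based: x_{2l-1} = coord x (2l), x_{2l} = coord x (2l+1), l < i. *)
Definition Vset (F : finFieldType) (m n d e s i : nat) : {set {ffun 'I_(2 * i) -> F}} :=
  [set x : {ffun 'I_(2 * i) -> F} |
     [forall j : 'I_s.+1,
        \sum_(l < i)
          (coord x (2 * l) *
             frobz m (((n %/ e)%:Z - (j : nat)%:Z) * d%:Z) (coord x (2 * l + 1))
           + frobz m (((n %/ e)%:Z - (j : nat)%:Z) * d%:Z) (coord x (2 * l))
             * coord x (2 * l + 1)) == 0]].

Definition gbinom (q : rat) (a b : nat) : rat :=
  if (b <= a)%N then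
    \prod_(k < b) ((q ^+ (a - k) - 1) / (q ^+ k.+1 - 1))
  else 0.

(* Main.v *)
From HB Require Import structures.
Require Import Defs.
From mathcomp Require Import all_boot all_order all_algebra all_field.
From mathcomp Require Import ring zify.
Import Order.TTheory GRing.Theory Num.Theory.
Local Open Scope ring_scope.

(** Put q = 2^e, Q = q^2 = 4^e, M = m/e and tau x = x^(2^d), whose fixed field K
    in F has q elements.  The equations defining V_{s,i} say that 2s+1
    consecutive twisted forms sum_l (x_l tau^k(y_l) + tau^k(x_l) y_l) vanish.
    For i <= s this forces all of them to vanish, because otherwise some
    triangular matrix of size 2i+1 and rank at most 2i would be invertible.
    Expanding over a K-basis of F, this means that the bivector sum_l x_l /\ y_l
    is zero, so |V_{s,i}| is the number f(M,i) of M-tuples of pairwise orthogonal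
    vectors in a symplectic K-space of dimension 2i.  Peeling off one vector,
    f(M+1,i) = f(M,i) + (Q^i - 1) q^M f(M,i-1).  Applied twice, this recursion
    becomes, for the alternating q-binomial sums of q^(-Mi) f(M,i), a recursion
    in steps of two in M which is solved by q^v prod_(j<v) (1 - Q^j / q^M). *)

(** * The q-binomial transform of the isotropic counts *)

(** At [i = 0] the factor [q ^ (2 * i) - 1] is zero, so the truncated [i.-1] does no harm. *)
Fixpoint isotropic_count (q M i : nat) : nat :=
  if M is M'.+1 then
    (isotropic_count q M' i
     + (q ^ (2 * i) - 1) * q ^ M' * isotropic_count q M' i.-1)%N
  else 1%N.

(** These are the entries of the inverse of the triangular matrix of Gaussian binomials. *)
Definition gauss_coef (Q : rat) (v i : nat) : rat :=
  (-1) ^+ (v - i) * Q ^+ 'C(v - i, 2) * gbinom Q v i.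

Lemma gbinom_small (Q : rat) v i : (v < i)%N -> gbinom Q v i = 0.
Proof. by rewrite /gbinom ltnNge => /negbTE ->. Qed.

Lemma expfS_neq1 (Q : rat) k : 1 < Q -> Q ^+ k.+1 - 1 != 0.
Proof. by move=> Q1; rewrite subr_eq0 gt_eqF // exprn_egt1. Qed.

Lemma gbinom_absorb (Q : rat) v i : 1 < Q ->
  (Q ^+ i.+1 - 1) * gbinom Q v.+1 i.+1 = (Q ^+ v.+1 - 1) * gbinom Q v i.
Proof.
move=> Q1; rewrite /gbinom ltnS; case: leqP => _; last by rewrite !mulr0.
rewrite !big_split /= big_ord_recl subn0 [\prod_(_ < i.+1) _]big_ord_recr /=.
under eq_bigr do rewrite /bump leq0n add1n subSS.
by field; apply: expfS_neq1.
Qed.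

Lemma gbinom_absorb_compl (Q : rat) v i : 1 < Q -> (i <= v)%N ->
  (Q ^+ (v.+1 - i) - 1) * gbinom Q v.+1 i = (Q ^+ v.+1 - 1) * gbinom Q v i.
Proof.
move=> Q1 iv; rewrite /gbinom iv leqW // !big_split /= !mulrA; congr (_ * _).
rewrite mulrC; transitivity (\prod_(k < i.+1) (Q ^+ (v.+1 - k) - 1)).
  by rewrite big_ord_recr.
by rewrite big_ord_recl subn0 /=; under eq_bigr do rewrite /bump leq0n add1n subSS.
Qed.

Lemma gauss_coef_absorb (Q : rat) v i : 1 < Q ->
  (Q ^+ i.+1 - 1) * gauss_coef Q v.+1 i.+1 = (Q ^+ v.+1 - 1) * gauss_coef Q v i.
Proof.
by move=> Q1; rewrite /gauss_coef subSS mulrCA gbinom_absorb // mulrCA.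
Qed.

(** For [i <= v], write [Q^i - Q^(v+1)] as [- Q^i (Q^(v+1-i) - 1)]. Complementary absorption takes
    care of the last factor, and [C(k+1,2) = C(k,2) + k] with [k = v - i] collects the powers of
    [Q]. *)
Lemma gauss_coef_shift (Q : rat) v i : 1 < Q ->
  Q ^+ i * gauss_coef Q v.+1 i
  = Q ^+ v.+1 * gauss_coef Q v.+1 i + Q ^+ v * (Q ^+ v.+1 - 1) * gauss_coef Q v i.
Proof.
move=> Q1; rewrite /gauss_coef; have [iv|vi|->] := ltngtP i v.+1.
- have /subnKC <- : (i <= v)%N by [].
  set k := (v - i)%N; have absorb := gbinom_absorb_compl Q (i + k) i Q1 (leq_addr _ _).
  rewrite -addnS !addKn in absorb *.
  rewrite [_ * _ * (_ * gbinom Q _ i)]mulrCA -[_ * _ * gbinom Q (i + k) i]mulrA -absorb.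
  by rewrite binS bin1 !exprD !exprS; ring.
- by rewrite !gbinom_small ?(ltnW vi) // !mulr0 addr0.
- by rewrite [gbinom Q v _]gbinom_small // !mulr0 addr0.
Qed.

(** By the q-binomial theorem at 1 the sum is the product of [1 - Q^j] over [j < v], whose first
    factor is zero. *)
Lemma sum_gauss_coef (Q : rat) v : 1 < Q ->
  \sum_(i < v.+1) gauss_coef Q v i = (v == 0%N)%:R.
Proof.
move=> Q1; have coefn0 u : gauss_coef Q u u.+1 = 0.
  by rewrite /gauss_coef gbinom_small ?mulr0.
have step u : \sum_(i < u.+2) gauss_coef Q u.+1 i
              = (1 - Q ^+ u) * \sum_(i < u.+1) gauss_coef Q u i.
  (* The sums weighted by [Q^i] and by [Q^i - 1] are known from shift and absorption; their
     difference is [A]. *)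
  apply: (mulfI (expfS_neq1 Q u Q1)).
  set A := \sum_(i < u.+2) _; set B := \sum_(i < u.+1) _.
  have: \sum_(i < u.+2) (Q ^+ i - 1) * gauss_coef Q u.+1 i = (Q ^+ u.+1 - 1) * B.
    rewrite big_ord_recl expr0 subrr mul0r add0r mulr_sumr.
    by apply: eq_bigr => i _; rewrite /= /bump leq0n add1n gauss_coef_absorb.
  have: \sum_(i < u.+2) Q ^+ i * gauss_coef Q u.+1 i
        = Q ^+ u.+1 * A + Q ^+ u * (Q ^+ u.+1 - 1) * B.
    under eq_bigr do rewrite gauss_coef_shift //.
    rewrite big_split /= -!mulr_sumr; congr (_ + _ * _).
    by rewrite big_ord_recr /= coefn0 addr0.
  under [\sum_(i < _) (_ - _) * _]eq_bigr do rewrite mulrBl mul1r.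
  rewrite sumrB -/A => -> H.
  transitivity (Q ^+ u.+1 * A + Q ^+ u * (Q ^+ u.+1 - 1) * B - A
                - Q ^+ u * (Q ^+ u.+1 - 1) * B); first by ring.
  by rewrite H; ring.
elim: v => [|v IH]; first by rewrite big_ord1 /gauss_coef /gbinom big_ord0.
by rewrite step IH; case: v {IH} => [|v]; rewrite ?expr0 ?subrr ?mul0r ?mulr0.
Qed.

Definition isotropic_moment (q M i : nat) : rat :=
  (isotropic_count q M i)%:R / q%:R ^+ (M * i).

Lemma isotropic_moment_rec q M i : (1 < q)%N ->
  q%:R ^+ i * isotropic_moment q M.+1 i
  = isotropic_moment q M i
    + ((q%:R ^+ 2) ^+ i - 1) * isotropic_moment q M i.-1.
Proof.
move=> q1; have q0 : q%:R != 0 :> rat by rewrite pnatr_eq0 -lt0n (ltnW q1).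
rewrite /isotropic_moment [isotropic_count _ M.+1 _]/= natrD !natrM natrB.
  rewrite !natrX -exprM; case: i => [|i].
    by rewrite !muln0 !expr0 subrr !mul0r; field.
  rewrite [i.+1.-1]/= [(M.+1 * _)%N]mulSn [(M * i.+1)%N]mulnS !exprD.
  by field; rewrite !expf_neq0.
by rewrite expn_gt0 (ltnW q1).
Qed.

(** One step produces the factor [q^i], but the identities for [gauss_coef] handle only [Q^i], hence
    the double step. The middle coefficient is [1 + q] because [q^i = q * q^(i-1)] leaves a spare
    [q] in the second step. *)
Lemma isotropic_moment_rec2 q M i : (1 < q)%N ->
  let Q : rat := q%:R ^+ 2 in
  Q ^+ i * isotropic_moment q M.+2 i
  = isotropic_moment q M i
    + (1 + q%:R) * ((Q ^+ i - 1) * isotropic_moment q M i.-1)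
    + q%:R * ((Q ^+ i - 1) * (Q ^+ i.-1 - 1) * isotropic_moment q M i.-2).
Proof.
move=> q1 Q; have rec := isotropic_moment_rec q _ _ q1.
have QE k : Q ^+ k = q%:R ^+ k * q%:R ^+ k by rewrite /Q -exprM mul2n -addnn exprD.
rewrite {1}QE -mulrA rec mulrDr rec -/Q; case: i => [|i].
  by rewrite !expr0 subrr; ring.
rewrite [i.+1.-1]/= [i.+1.-2]/= [_%:R ^+ i.+1]exprS; transitivity
  (isotropic_moment q M i.+1 + (Q ^+ i.+1 - 1) * isotropic_moment q M i
   + q%:R * ((Q ^+ i.+1 - 1) * (q%:R ^+ i * isotropic_moment q M.+1 i))).
  by ring.
by rewrite rec -/Q; ring.
Qed.

Definition gauss_moment (q M v : nat) : rat :=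
  \sum_(i < v.+1) gauss_coef (q%:R ^+ 2) v i * isotropic_moment q M i.

Lemma gauss_moment_extend q M v :
  \sum_(i < v.+2) gauss_coef (q%:R ^+ 2) v i * isotropic_moment q M i
  = gauss_moment q M v.
Proof.
by rewrite big_ord_recr /= {2}/gauss_coef gbinom_small // mulr0 mul0r addr0.
Qed.

Lemma gauss_moment_absorb q M v : (1 < q)%N ->
  let Q : rat := q%:R ^+ 2 in
  \sum_(i < v.+2) gauss_coef Q v.+1 i * ((Q ^+ i - 1) * isotropic_moment q M i.-1)
  = (Q ^+ v.+1 - 1) * gauss_moment q M v.
Proof.
move=> q1 Q; have Q1 : 1 < Q by rewrite /Q exprn_egt1 // ltr1n.
rewrite big_ord_recl expr0 subrr mul0r mulr0 add0r mulr_sumr.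
apply: eq_bigr => i _; rewrite /= /bump leq0n add1n.
by rewrite mulrA [gauss_coef _ _ _ * _]mulrC gauss_coef_absorb // mulrA.
Qed.

Lemma gauss_moment_absorb2 q M v : (1 < q)%N ->
  let Q : rat := q%:R ^+ 2 in
  \sum_(i < v.+3) gauss_coef Q v.+2 i
     * ((Q ^+ i - 1) * (Q ^+ i.-1 - 1) * isotropic_moment q M i.-2)
  = (Q ^+ v.+2 - 1) * (Q ^+ v.+1 - 1) * gauss_moment q M v.
Proof.
move=> q1 Q; have Q1 : 1 < Q by rewrite /Q exprn_egt1 // ltr1n.
rewrite big_ord_recl expr0 subrr !mul0r mulr0 add0r -mulrA -gauss_moment_absorb //.
rewrite mulr_sumr; apply: eq_bigr => i _; rewrite /= /bump leq0n add1n /=.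
transitivity ((Q ^+ i.+1 - 1) * gauss_coef Q v.+2 i.+1
              * ((Q ^+ i - 1) * isotropic_moment q M i.-1)); first by ring.
by rewrite gauss_coef_absorb //; ring.
Qed.

Lemma gauss_moment_shift q M v : (1 < q)%N ->
  let Q : rat := q%:R ^+ 2 in
  \sum_(i < v.+2) gauss_coef Q v.+1 i * (Q ^+ i * isotropic_moment q M i)
  = Q ^+ v.+1 * gauss_moment q M v.+1
    + Q ^+ v * (Q ^+ v.+1 - 1) * gauss_moment q M v.
Proof.
move=> q1 Q; have Q1 : 1 < Q by rewrite /Q exprn_egt1 // ltr1n.
rewrite -(gauss_moment_extend q M v) !mulr_sumr -big_split.
apply: eq_bigr => i _ /=.
by rewrite mulrA [gauss_coef _ _ _ * _]mulrC gauss_coef_shift //; ring.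
Qed.

(** The two-step recursion is summed against [gauss_coef Q v.+1]: the left side is evaluated by the
    shift, the right side by absorbing once and twice. At [v = 0] the factor [Q^v - 1] kills the
    term with [v.-1]. *)
Lemma gauss_moment_rec q M v : (1 < q)%N ->
  let Q : rat := q%:R ^+ 2 in
  Q ^+ v.+1 * gauss_moment q M.+2 v.+1
    + Q ^+ v * (Q ^+ v.+1 - 1) * gauss_moment q M.+2 v
  = gauss_moment q M v.+1 + (1 + q%:R) * ((Q ^+ v.+1 - 1) * gauss_moment q M v)
    + q%:R * ((Q ^+ v.+1 - 1) * (Q ^+ v - 1) * gauss_moment q M v.-1).
Proof.
move=> q1 Q; rewrite -gauss_moment_shift // -/Q -gauss_moment_absorb // -/Q.
have -> : (Q ^+ v.+1 - 1) * (Q ^+ v - 1) * gauss_moment q M v.-1 =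
  \sum_(i < v.+2) gauss_coef Q v.+1 i
     * ((Q ^+ i - 1) * (Q ^+ i.-1 - 1) * isotropic_moment q M i.-2).
  case: v => [|v]; last by rewrite gauss_moment_absorb2.
  by rewrite !big_ord_recl big_ord0 /= !expr0 subrr !mul0r !mulr0 !mul0r mulr0 !addr0.
rewrite !mulr_sumr -!big_split; apply: eq_bigr => i _ /=.
by rewrite isotropic_moment_rec2 // -/Q; ring.
Qed.

(** The recursion determines the value at [(n+1, v+1)] from those at [(n+1, v)] and at [n], so two
    nested inductions verify the closed form. *)
Lemma gauss_moment_even q n v : (1 < q)%N ->
  let Q : rat := q%:R ^+ 2 in
  gauss_moment q (2 * n) v = q%:R ^+ v * \prod_(j < v) (1 - Q ^+ j / Q ^+ n).
Proof.
move=> q1 Q; have Q1 : 1 < Q by rewrite /Q exprn_egt1 // ltr1n.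
have q0 : q%:R != 0 :> rat by rewrite pnatr_eq0 -lt0n (ltnW q1).
have Q0 : Q != 0 by rewrite expf_neq0.
have zero k : gauss_moment q k 0 = 1.
  rewrite /gauss_moment big_ord1 /gauss_coef /gbinom big_ord0 /isotropic_moment.
  rewrite muln0 !expr0 divr1 !mul1r.
  by elim: k => [|k IH] //=; rewrite muln0 mul0n addn0.
elim: n v => [|n IHn] v.
  (* For [n = 0] every moment is 1, so the alternating sum vanishes when [v > 0]; so does the
     product, by its factor at [j = 0]. *)
  rewrite /gauss_moment muln0.
  under eq_bigr do rewrite /isotropic_moment mul0n expr0 divr1 mulr1.
  rewrite sum_gauss_coef //; case: v => [|v]; first by rewrite big_ord0 mulr1.
  by rewrite big_ord_recl !expr0 divr1 subrr mul0r mulr0.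
rewrite mulnS; elim: v => [|v IHv]; first by rewrite zero big_ord0 mulr1.
have := gauss_moment_rec q (2 * n) v q1; rewrite -/Q IHv !IHn.
set G := gauss_moment _ _ _ => recG.
apply: (mulfI (expf_neq0 v.+1 Q0)).
have {recG} -> := canRL (addrK _) recG.
have shift k : \prod_(j < k.+1) (1 - Q ^+ j / Q ^+ n.+1) =
    (1 - (Q ^+ n.+1)^-1) * \prod_(j < k) (1 - Q ^+ j / Q ^+ n).
  rewrite big_ord_recl expr0 mul1r; congr (_ * _); apply: eq_bigr => j _.
  by rewrite /= /bump leq0n add1n !exprS invfM mulrACA divff // mul1r.
have Qn0 := expf_neq0 n Q0.
case: v {IHv G} => [|v].
  rewrite shift !big_ord_recl !big_ord0 !expr0 (exprS Q n) !expr1.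
  set Qn := Q ^+ n in Qn0 *; rewrite /Q.
  by field; rewrite Qn0 q0.
rewrite !shift !big_ord_recr /= (exprS Q n).
set W := \prod_(i < v) _; set Qn := Q ^+ n in Qn0 *; rewrite !exprS.
set Qv := Q ^+ v; set qv := _ ^+ v; rewrite /Q.
by field; rewrite Qn0 q0.
Qed.

(** * Isotropic tuples for alternating forms over a finite field *)

(** Both conditions are recorded since skew-symmetry does not imply alternation in characteristic
    2. *)
Definition alternating_mx (K : fieldType) N (J : 'M[K]_N) : Prop :=
  J^T = - J /\ forall u : 'rV_N, u *m J *m u^T = 0.

Definition isotropic_tuples (K : finFieldType) M N (J : 'M[K]_N) :
  {set 'M[K]_(M, N)} := [set A | A *m J *m A^T == 0].

Lemma alternating_congr (K : fieldType) N N' (J : 'M[K]_N) (C : 'M[K]_(N', N)) :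
  alternating_mx K N J -> alternating_mx K N' (C *m J *m C^T).
Proof.
case=> skew alt; split=> [|u].
  by rewrite !trmx_mul trmxK skew mulNmx mulmxN mulmxA.
by rewrite -(alt (u *m C)) trmx_mul !mulmxA.
Qed.

Lemma alternating_tr0 (K : fieldType) M N (J : 'M[K]_N) (B : 'M_(M, N)) u :
  alternating_mx K N J -> B *m J *m u^T = 0 -> u *m J *m B^T = 0 :> 'M_(1, M).
Proof.
case=> skew _ /(congr1 trmx); rewrite !trmx_mul trmxK skew trmx0.
by rewrite mulNmx mulmxN mulmxA => /eqP; rewrite oppr_eq0 => /eqP.
Qed.

Lemma rank_kermx_col (K : fieldType) N (w : 'cV[K]_N) :
  w != 0 -> (\rank (kermx w)).+1 = N.
Proof.
move=> w0; have rw : \rank w = 1%N.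
  by apply/eqP; rewrite eqn_leq rank_leq_col lt0n mxrank_eq0.
by rewrite mxrank_ker rw subn1 prednK //; have := rank_leq_row w; rewrite rw.
Qed.

(* The restriction of an alternating form to the hyperplane u^perp, with u
   outside the radical, has radical Rad J + <u>, so the rank drops by two. *)
Lemma rank_alternating_perp (K : fieldType) N (J : 'M[K]_N) (u : 'rV_N) :
  alternating_mx K N J -> u *m J != 0 ->
  let C := row_base (kermx (J *m u^T)) in
  (\rank (C *m J *m C^T)).+2 = \rank J.
Proof.
move=> altJ uJ C; have [skew alt] := altJ.
have w0 : J *m u^T != 0.
  apply: contra_neq uJ => /(congr1 trmx); rewrite trmx_mul trmxK skew mulmxN trmx0.
  by move/eqP; rewrite oppr_eq0 => /eqP.
have rkC := rank_kermx_col K N _ w0.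
have memC p (v : 'M_(p, N)) : (v <= C)%MS = (v *m J *m u^T == 0).
  by rewrite eq_row_base -mulmxA; apply/sub_kermxP/eqP.
have rC : (\rank C).+1 = N by rewrite -[RHS]rkC eq_row_base.
(* The hyperplane contains the kernel of [J], so its image under [J] loses exactly one dimension. *)
have rCJ : (\rank (C *m J)).+1 = \rank J.
  have kerC : (kermx J <= C)%MS by rewrite memC mulmx_ker mul0mx.
  have := mxrank_mul_ker C J; rewrite (capmx_idPr kerC) (mxrank_ker J).
  by have := rank_leq_row J; lia.
(* The annihilator of the hyperplane is a line, and the nonzero vector [u *m J] lies in the
   intersection. *)
have rcap : \rank (C *m J :&: kermx C^T)%MS = 1%N.
  have sub1 : (u *m J <= C *m J :&: kermx C^T)%MS.
    rewrite sub_capmx submxMr; last by rewrite memC alt.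
    apply/sub_kermxP/(alternating_tr0 K _ _ _ _ _ altJ)/eqP.
    by rewrite -memC.
  apply/eqP; rewrite eqn_leq; apply/andP; split.
    apply: leq_trans (mxrankS (capmxSr _ _)) _.
    by rewrite (mxrank_ker C^T) mxrank_tr; lia.
  by apply: leq_trans (mxrankS sub1); rewrite lt0n mxrank_eq0.
by have := mxrank_mul_ker (C *m J) C^T; rewrite rcap; lia.
Qed.

Lemma card_rad (K : finFieldType) N (J : 'M[K]_N) :
  #|[set u : 'rV_N | u *m J == 0]| = (#|K| ^ (N - \rank J))%N.
Proof.
rewrite -mxrank_ker -[X in (_ ^ X)%N]mul1n -card_mx.
rewrite -(card_imset _ (row_free_inj (row_base_free (kermx J)))).
apply: eq_card => u; rewrite !inE; apply/eqP/imsetP => [/sub_kermxP|[v _ ->]].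
  by rewrite -(eq_row_base (kermx J)) => /submxP[v ->]; exists v.
by apply/sub_kermxP; rewrite -(eq_row_base (kermx J)) submxMl.
Qed.

Lemma card_isotropic_sub (K : finFieldType) M N p (J : 'M[K]_N) (C : 'M_(p, N)) :
  row_free C ->
  #|[set B in isotropic_tuples K M N J | (B <= C)%MS]|
  = #|isotropic_tuples K M p (C *m J *m C^T)|.
Proof.
move=> freeC; rewrite -(card_imset _ (row_free_inj freeC)).
have congrC (D : 'M_(M, p)) :
    D *m (C *m J *m C^T) *m D^T = D *m C *m J *m (D *m C)^T.
  by rewrite trmx_mul !mulmxA.
apply: eq_card => B; rewrite !inE; apply/andP/imsetP => [[BJB /submxP[D defB]]|].
  by exists D => //; rewrite inE congrC -defB.
by case=> D; rewrite inE congrC => DJD ->; rewrite submxMl.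
Qed.

(** Split off the first row [u]: its diagonal entry in the Gram matrix is zero by alternation, and
    skew-symmetry makes the two cross blocks vanish together. *)
Lemma card_isotropicS (K : finFieldType) M N (J : 'M[K]_N) :
  alternating_mx K N J ->
  #|isotropic_tuples K M.+1 N J|
  = (\sum_(u : 'rV[K]_N)
       #|[set B in isotropic_tuples K M N J | B *m J *m u^T == 0%R]|)%N.
Proof.
move=> altJ; have [_ alt] := altJ.
transitivity #|[set p : 'rV[K]_N * 'M[K]_(M, N) |
   (p.2 *m J *m p.2^T == 0) && (p.2 *m J *m p.1^T == 0)]|.
  pose f (p : 'rV[K]_N * 'M[K]_(M, N)) : 'M[K]_(1 + M, N) := col_mx p.1 p.2.
  have f_inj : injective f by move=> [u B] [u' B'] /eq_col_mx /= [-> ->].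
  rewrite -(card_imset _ f_inj); apply: eq_card => A; rewrite inE.
  have cond (u : 'rV_N) (B : 'M_(M, N)) :
      (f (u, B) *m J *m (f (u, B))^T == 0)
      = (B *m J *m B^T == 0) && (B *m J *m u^T == 0).
    rewrite /f mul_col_mx tr_col_mx mul_col_row alt /=.
    apply/eqP/andP => [|[/eqP-> BJu]].
      by rewrite -[RHS]block_mx0 => /eq_block_mx[_ _ -> ->].
    by rewrite (alternating_tr0 K _ _ _ _ _ altJ) ?(eqP BJu) // block_mx0.
  apply/idP/imsetP => [|[[u B] + ->]]; last by rewrite inE -cond.
  have defA : A = f (@usubmx _ 1 M N A, @dsubmx _ 1 M N A) by rewrite /f /= vsubmxK.
  move=> isoA; have := isoA; rewrite {1 2}defA cond => condA.
  by exists (@usubmx _ 1 M N A, @dsubmx _ 1 M N A); rewrite ?inE.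
pose perp (u : 'rV[K]_N) := [set B in isotropic_tuples K M N J | B *m J *m u^T == 0].
transitivity (\sum_(p : 'rV[K]_N * 'M[K]_(M, N) |
                  (p.1 \in predT) && (p.2 \in perp p.1)) 1)%N.
  by rewrite -sum1_card; apply: eq_bigl => p; rewrite !inE.
rewrite -(pair_big_dep predT (fun u B => B \in perp u) (fun _ _ => 1%N)) /=.
by apply: eq_bigr => u _; rewrite sum1_card.
Qed.

(** Induction on [M] over the first vector [u]. If [u] is in the radical it imposes no condition;
    otherwise the other vectors lie in the hyperplane orthogonal to [u], where the rank is
    [2 * (i - 1)]. Degenerate [J] must be allowed because this restricted form has a larger
    radical. *)
Lemma card_isotropic (K : finFieldType) M N i (J : 'M[K]_N) :
  alternating_mx K N J -> \rank J = (2 * i)%N ->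
  #|isotropic_tuples K M N J|
  = (#|K| ^ (M * (N - 2 * i)) * isotropic_count #|K| M i)%N.
Proof.
elim: M N i J => [|M IH] N i J altJ rJ.
  rewrite mul0n -(mul0n N) -card_mx muln1.
  by apply: eq_card => A; rewrite !inE; apply/eqP; apply: flatmx0.
have leN := rank_leq_row J; rewrite rJ in leN.
rewrite card_isotropicS // (bigID (fun u => u *m J == 0)) [LHS]/=.
rewrite (eq_bigr (fun=> #|K| ^ (M * (N - 2 * i)) * isotropic_count #|K| M i)%N);
  last first.
  move=> u /eqP uJ; rewrite -(IH N i J) //; apply: eq_card => B; rewrite !inE.
  case: eqP => //= _; apply/eqP; rewrite -trmx0 -[B *m J *m _]trmxK; congr _^T.
  rewrite !trmx_mul trmxK; have [-> _] := altJ.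
  by rewrite mulNmx mulmxN mulmxA uJ mul0mx oppr0.
(* The hyperplane has dimension [N - 1], so its radical has dimension [N - 2i + 1]; this is the
   extra [M] in the exponent. *)
rewrite [X in (_ + X)%N](eq_bigr (fun=>
  #|K| ^ (M * (N - 2 * i) + M) * isotropic_count #|K| M i.-1)%N); last first.
  move=> u uJ; set C := row_base (kermx (J *m u^T)).
  transitivity #|[set B in isotropic_tuples K M N J | (B <= C)%MS]|.
    apply: eq_card => B; rewrite !inE eq_row_base; congr (_ && _); rewrite -mulmxA.
    by apply/eqP/sub_kermxP.
  rewrite card_isotropic_sub ?row_base_free //.
  have rk := rank_alternating_perp K N J u altJ uJ; rewrite rJ in rk.
  rewrite (IH _ i.-1); first 1 last.
  - exact: alternating_congr.
  - by case: (i) rk => [//|k]; rewrite mulnS => -[rk]; exact: rk.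
  congr (_ ^ _ * _)%N; rewrite -mulnSr.
  have uJ0 : J *m u^T != 0.
    apply: contra_neq uJ => Ju; have [skew _] := altJ.
    by rewrite -[u *m J]trmxK trmx_mul skew mulNmx Ju oppr0 trmx0.
  move: rk (rank_kermx_col K N _ uJ0); rewrite -/C /=; nia.
rewrite !sum_nat_const.
have -> : #|[pred u : 'rV_N | u *m J == 0]| = (#|K| ^ (N - 2 * i))%N.
  by rewrite -rJ -card_rad; apply: eq_card => u; rewrite !inE.
have -> : #|[pred u : 'rV_N | u *m J != 0]| = (#|K| ^ N - #|K| ^ (N - 2 * i))%N.
  rewrite -rJ -card_rad -[(#|K| ^ N)%N](congr1 (expn #|K|) (mul1n N)) -card_mx.
  rewrite -(cardsC [set u : 'rV_N | u *m J == 0]) addKn.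
  by apply: eq_card => u; rewrite !inE.
have -> : (#|K| ^ N = #|K| ^ (N - 2 * i) * #|K| ^ (2 * i))%N by rewrite -expnD subnK.
have -> : isotropic_count #|K| M.+1 i = (isotropic_count #|K| M i
   + (#|K| ^ (2 * i) - 1) * #|K| ^ M * isotropic_count #|K| M i.-1)%N by [].
rewrite (mulSn M) (expnD _ _ M) (expnD _ (N - _)).
set x := (_ ^ (N - _))%N; set y := (_ ^ (2 * i))%N; set z := (_ ^ M)%N.
have : (0 < y)%N by rewrite expn_gt0 (ltnW (finNzRing_gt1 K)).
case: y => // y _; rewrite subn1 /= mulnS addKn.
by ring.
Qed.

(** * Fixed field of a Frobenius power *)

(** The proof [char2] is a parameter so that the closure instances below can be attached to the
    predicate. *)
Definition frob_fixed (F : finFieldType) (char2 : 2%N \in [pchar F]) (k : nat) :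
  {pred F} := [pred x | x ^+ (2 ^ k) == x].


Lemma frobD (F : comNzRingType) k : 2%N \in [pchar F] ->
  {morph (fun x : F => x ^+ (2 ^ k)) : x y / x + y}.
Proof.
by move=> char2 x y; rewrite exprDn_pchar // (eq_pnat _ (pcharf_eq char2)) pnatX pnat_id.
Qed.

Lemma frob_fixed_divring F char2 k : divring_closed (frob_fixed F char2 k).
Proof.
split=> [|x y|x y]; rewrite !inE ?expr1n // => /eqP fx /eqP fy; apply/eqP.
  by rewrite !(oppr_pchar2 char2) frobD // fx fy.
by rewrite expr_div_n fx fy.
Qed.

HB.instance Definition _ (F : finFieldType) (char2 : 2%N \in [pchar F]) k :=
  GRing.isDivringClosed.Build F (frob_fixed F char2 k) (frob_fixed_divring F char2 k).

Record frob_subfield (F : finFieldType) (char2 : 2%N \in [pchar F]) k :=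
  FrobSubfield {frob_val : F; _ : frob_val \in frob_fixed F char2 k}.
Arguments frob_val {F char2 k}.

HB.instance Definition _ (F : finFieldType) (char2 : 2%N \in [pchar F]) k :=
  [isSub for @frob_val F char2 k].
HB.instance Definition _ (F : finFieldType) (char2 : 2%N \in [pchar F]) k :=
  [Finite of frob_subfield F char2 k by <:].
HB.instance Definition _ (F : finFieldType) (char2 : 2%N \in [pchar F]) k :=
  [SubChoice_isSubComUnitRing of frob_subfield F char2 k by <:].
HB.instance Definition _ (F : finFieldType) (char2 : 2%N \in [pchar F]) k :=
  [SubComUnitRing_isSubIntegralDomain of frob_subfield F char2 k by <:].
HB.instance Definition _ (F : finFieldType) (char2 : 2%N \in [pchar F]) k :=
  [SubIntegralDomain_isSubField of frob_subfield F char2 k by <:].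

(** The polynomial [X^(2^k) - X] divides [X^#|F| - X], the product of all [X - x], so it has [2^k]
    distinct roots in [F]. *)
Lemma card_frob_subfield (F : finFieldType) (char2 : 2%N \in [pchar F]) k r :
  (0 < k)%N -> #|F| = (2 ^ (k * r))%N -> #|{: frob_subfield F char2 k}| = (2 ^ k)%N.
Proof.
move=> k0 cardF; rewrite card_sub.
pose p : {poly F} := 'X^(2 ^ k) - 'X.
have size_p : size p = (2 ^ k).+1.
  by rewrite size_polyDl size_polyXn // size_polyN size_polyX ltnS (ltn_exp2l 0).
have p_dvd u : p %| 'X^(2 ^ (k * u)) - 'X.
  elim: u => [|u IHu]; first by rewrite muln0 expn0 subrr dvdp0.
  rewrite mulnS expnD mulnC exprM -(subrK ('X^(2 ^ k)) (_ ^+ (2 ^ k))) -addrA.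
  by rewrite dvdp_add // subrXX dvdp_mulr.
have := p_dvd r; rewrite -cardF finField_genPoly => /dvdp_prod_XsubC[msk p_eq].
have uniq_msk : uniq (mask msk (index_enum F)) by rewrite mask_uniq ?index_enum_uniq.
have size_msk : size (mask msk (index_enum F)) = (2 ^ k)%N.
  by have := eqp_size p_eq; rewrite size_p size_prod_XsubC => -[].
rewrite -size_msk -(card_uniqP uniq_msk); apply: eq_card => x.
rewrite !inE -root_prod_XsubC -(eqp_root p_eq) /root !hornerE.
by rewrite subr_eq0.
Qed.

(** Greedy choice: fewer than [r + 1] vectors span too few elements to fill [F], so a vector outside
    the span can be added. *)
Lemma exists_frob_basis (K F : finFieldType) (phi : {rmorphism K -> F}) r :
  (#|K| ^ r <= #|F|)%N ->
  exists e : 'rV[F]_r, forall c : 'cV[K]_r, e *m map_mx phi c = 0 -> c = 0.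
Proof.
elim: r => [|r IHr] leF; first by exists 0 => c _; apply: flatmx0.
have K1 : (1 < #|K|)%N := finNzRing_gt1 K.
have ltF : (#|K| ^ r < #|F|)%N by apply: leq_trans leF; rewrite ltn_exp2l.
have [e e_free] := IHr (ltnW ltF).
have [y ny] : exists y : F, forall c : 'cV_r, (e *m map_mx phi c) 0 0 <> y.
  pose im := [set (e *m map_mx phi c) 0 0 | c : 'cV[K]_r].
  have /subsetPn[y _ ny] : ~~ ([set: F] \subset im).
    apply: contraL ltF => /subset_leq_card; rewrite cardsT -leqNgt => /leq_trans->//.
    by rewrite (leq_trans (leq_imset_card _ _)) // card_mx muln1.
  by exists y => c cy; case/imsetP: ny; exists c.
suff: exists e : 'rV[F]_(1 + r), forall c : 'cV[K]_(1 + r),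
  e *m map_mx phi c = 0 -> c = 0 by [].
exists (row_mx y%:M e) => c; rewrite -[c]vsubmxK map_col_mx mul_row_col.
move: (usubmx _) (dsubmx _) => a b; rewrite [a]mx11_scalar map_scalar_mx -scalar_mxM.
move/matrixP/(_ 0 0); rewrite !mxE eqxx mulr1n.
have [-> | a0] := eqVneq (a 0 0) 0.
  rewrite rmorph0 mulr0 add0r => eb; rewrite (e_free b).
    by rewrite raddf0 col_mx0.
  by apply/matrixP=> i j; rewrite !ord1 !mxE.
move=> eq0; case: (ny (- (a 0 0)^-1 *: b)).
rewrite map_mxZ -scalemxAr !mxE rmorphN fmorphV mulNr.
have phia0 : phi (a 0 0) != 0 by rewrite fmorph_eq0.
apply: (mulfI phia0); rewrite mulrN mulrA divff // mul1r mulrC.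
by apply/eqP; rewrite eq_sym -addr_eq0 eq0.
Qed.

(** * Twisted forms *)

Definition frob_iter (F : finFieldType) (d a : nat) (x : F) : F := x ^+ (2 ^ (d * a)).

Lemma frob_iter_add (F : finFieldType) d a b (x : F) :
  frob_iter F d a (frob_iter F d b x) = frob_iter F d (a + b) x.
Proof. by rewrite /frob_iter -exprM -expnD -mulnDr addnC. Qed.

Lemma frob_iterM (F : finFieldType) d a (x y : F) :
  frob_iter F d a (x * y) = frob_iter F d a x * frob_iter F d a y.
Proof. exact: exprMn. Qed.

Lemma frob_iter0 (F : finFieldType) d a : frob_iter F d a 0 = 0.
Proof. by rewrite /frob_iter expr0n gtn_eqF ?expn_gt0. Qed.

Lemma frob_iter_eq0 (F : finFieldType) d a (x : F) : (frob_iter F d a x == 0) = (x == 0).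
Proof. by rewrite /frob_iter expf_eq0 expn_gt0. Qed.

Lemma frob_iter_sum (F : finFieldType) d a I r (P : pred I) (f : I -> F) :
  2%N \in [pchar F] ->
  frob_iter F d a (\sum_(i <- r | P i) f i) = \sum_(i <- r | P i) frob_iter F d a (f i).
Proof.
move=> char2; apply: (big_morph _ (frobD F (d * a) char2)).
exact: frob_iter0.
Qed.

(** The defining equations need only [a = 0]; two exponents allow Frobenius shifts and Gram-type
    matrices. *)
Definition twisted_form (F : finFieldType) (d i : nat) (x y : 'rV[F]_i) (a b : nat) : F :=
  \sum_(l < i) (frob_iter F d a (x 0 l) * frob_iter F d b (y 0 l)
                + frob_iter F d b (x 0 l) * frob_iter F d a (y 0 l)).

Lemma twisted_form_sym (F : finFieldType) d i (x y : 'rV[F]_i) a b :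
  twisted_form F d i x y a b = twisted_form F d i x y b a.
Proof. by apply: eq_bigr => l _; rewrite addrC. Qed.

Lemma twisted_form_shift (F : finFieldType) d i (x y : 'rV[F]_i) a b t :
  2%N \in [pchar F] ->
  twisted_form F d i x y (t + a) (t + b) = frob_iter F d t (twisted_form F d i x y a b).
Proof.
move=> char2; rewrite /twisted_form frob_iter_sum //; apply: eq_bigr => l _.
by rewrite -!frob_iter_add -!frob_iterM; apply/esym/frobD.
Qed.

(* The Gram-type matrix below has rank at most 2i, while vanishing of 2i
   consecutive twisted forms makes it triangular of size 2i + 1. *)
Lemma twisted_form_next (F : finFieldType) d i (x y : 'rV[F]_i) k :
  2%N \in [pchar F] ->
  (forall t, (t < i + i)%N -> twisted_form F d i x y 0 (k + t) = 0) ->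
  twisted_form F d i x y 0 (k + (i + i)) = 0.
Proof.
move=> char2 run; set N := (i + i)%N in run *.
pose P := \matrix_(a < N.+1, b < N.+1) twisted_form F d i x y b (k + N + a).
pose tx c := frob_iter F d c \o x 0; pose ty c := frob_iter F d c \o y 0.
have trigP : is_trig_mx P.
  apply/is_trig_mxP => a b ab; rewrite mxE.
  (* Undoing a shift by [b] leaves the index [k + (N + a - b)], within the run when [a < b]; on the
     diagonal it is [k + N], the unknown value. *)
  have -> : (k + N + a = b + (k + (N + a - b)))%N by have := ltn_ord b; lia.
  rewrite -{1}[nat_of_ord b]addn0 twisted_form_shift // run ?frob_iter0 //.
  by have := ltn_ord b; lia.
apply/eqP; apply: contraT => nz.
have unitP : P \in unitmx.
  rewrite unitmxE det_trig // unitfE prodf_seq_neq0; apply/allP => a _ /=.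
  by rewrite mxE addnC -{1}[nat_of_ord a]addn0 twisted_form_shift // frob_iter_eq0.
have [U [V defP]] : exists (U : 'M_(N.+1, i + i)) (V : 'M_(i + i, N.+1)), P = U *m V.
  exists (row_mx (\matrix_(a, l) frob_iter F d (k + N + a) (y 0 l))
                 (\matrix_(a, l) frob_iter F d (k + N + a) (x 0 l))).
  exists (col_mx (\matrix_(l, b) frob_iter F d b (x 0 l))
                 (\matrix_(l, b) frob_iter F d b (y 0 l))).
  apply/matrixP => a b; rewrite mul_row_col !mxE -big_split /=.
  by apply: eq_bigr => l _; rewrite !mxE mulrC.
by have := mulmx_max_rank U V; rewrite -defP mxrank_unit // ltnn.
Qed.

Lemma twisted_form_period (F : finFieldType) d M i (x y : 'rV[F]_i) a b k :
  (forall z : F, frob_iter F d M z = z) ->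
  twisted_form F d i x y a (M * k + b) = twisted_form F d i x y a b.
Proof.
move=> per; apply: eq_bigr => l _; have perk z : frob_iter F d (M * k) z = z.
  elim: k => [|k IHk]; first by rewrite /frob_iter !muln0 expn0 expr1.
  by rewrite mulnS -frob_iter_add IHk.
by rewrite -!frob_iter_add !perk.
Qed.

(** The run of zeros propagates upwards, and periodicity carries every index to one at least
    [k0]. *)
Lemma twisted_form_vanish (F : finFieldType) d M i (x y : 'rV[F]_i) k0 :
  2%N \in [pchar F] -> (0 < M)%N -> (forall z : F, frob_iter F d M z = z) ->
  (forall t, (t < i + i)%N -> twisted_form F d i x y 0 (k0 + t) = 0) ->
  forall k, twisted_form F d i x y 0 k = 0.
Proof.
move=> char2 M0 per run.
have after t : twisted_form F d i x y 0 (k0 + t) = 0.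
  elim/ltn_ind: t => t IHt; have [/run // | le_t] := ltnP t (i + i).
  rewrite -(subnK le_t) addnA; apply: twisted_form_next => // u lt_u.
  by rewrite -addnA; apply: IHt; lia.
move=> k; rewrite -(twisted_form_period F d M i x y 0 k k0) //.
by rewrite -(subnKC (_ : k0 <= M * k0 + k)%N) //; nia.
Qed.

Lemma expf_frob_mod (F : finFieldType) m k (x : F) :
  #|F| = (2 ^ m)%N -> x ^+ (2 ^ (k %% m)) = x ^+ (2 ^ k).
Proof.
move=> cardF; rewrite {2}(divn_eq k m); elim: (k %/ m)%N => // u IHu.
by rewrite mulSn -addnA expnD exprM -cardF expf_card.
Qed.

(** After reduction modulo [m] the exponents are distinct and below [2^m], so a relation is a
    polynomial of degree less than [#|F|] vanishing on all of [F]. *)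
Lemma frob_iter_indep (F : finFieldType) m d M (v : 'I_M -> F) :
  #|F| = (2 ^ m)%N -> (0 < m)%N ->
  (forall a b : 'I_M, d * a = d * b %[mod m] -> a = b)%N ->
  (forall z, \sum_a v a * frob_iter F d a z = 0) -> forall a, v a = 0.
Proof.
move=> cardF m0 inj vanish a; pose ex (b : 'I_M) := (2 ^ ((d * b) %% m))%N.
have ex_inj b : (ex a == ex b) = (a == b).
  by rewrite eqn_exp2l //; apply/eqP/eqP => [/inj|->].
pose p := \sum_b v b *: 'X^(ex b).
have -> : v a = p`_(ex a).
  rewrite coef_sum (bigD1 a) //= coefZ coefXn eqxx mulr1 big1 ?addr0 // => b ba.
  by rewrite coefZ coefXn ex_inj eq_sym (negPf ba) mulr0.
suff -> : p = 0 by rewrite coef0.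
apply/eqP; apply: contraT => p0.
have := max_poly_roots p0 (_ : all (root p) (enum F)) (enum_uniq F).
rewrite -cardE cardF ltnNge => /(_ _)/negP[].
  apply/allP => z _; rewrite /root horner_sum -{2}(vanish z); apply/eqP/eq_bigr => b _.
  by rewrite !hornerE (expf_frob_mod _ m).
apply: (leq_trans (size_sum _ _ _)); apply/bigmax_leqP => b _.
by rewrite (leq_trans (size_scale_leq _ _)) // size_polyXn ltn_exp2l // ltn_mod.
Qed.

(** The middle matrix holds the coordinates of the bivector [sum_l x_l /\ y_l]; signs are free in
    characteristic 2. *)
Lemma twisted_form_coord (K F : finFieldType) (phi : {rmorphism K -> F}) d M i
  (e : 'rV[F]_M) (X Y : 'M[K]_(M, i)) a b :
  2%N \in [pchar F] -> (forall c k, frob_iter F d k (phi c) = phi c) ->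
  twisted_form F d i (e *m map_mx phi X) (e *m map_mx phi Y) a b
  = (map_mx (frob_iter F d a) e *m map_mx phi (X *m Y^T - Y *m X^T)
       *m (map_mx (frob_iter F d b) e)^T) 0 0.
Proof.
move=> char2 fixed.
have frobE k (Z : 'M[K]_(M, i)) l : frob_iter F d k ((e *m map_mx phi Z) 0 l)
    = (map_mx (frob_iter F d k) e *m map_mx phi Z) 0 l.
  rewrite !mxE frob_iter_sum //; apply: eq_bigr => p _.
  by rewrite frob_iterM !mxE fixed.
rewrite /twisted_form; under eq_bigr do rewrite !frobE.
set Ea := map_mx _ e; set Eb := map_mx _ e; rewrite big_split /=.
transitivity (((Ea *m map_mx phi X) *m (Eb *m map_mx phi Y)^T) 0 0
            + ((Ea *m map_mx phi Y) *m (Eb *m map_mx phi X)^T) 0 0).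
  rewrite !mxE; congr (_ + _); apply: eq_bigr => l _; rewrite [in RHS]mxE ?mxE //.
  by rewrite mulrC.
rewrite -[X in _ + X](oppr_pchar2 char2) raddfB /= !map_mxM mulmxBr mulmxBl.
by rewrite !trmx_mul !map_trmx !mulmxA [in RHS]mxE [(- _ : 'M_1) 0 0]mxE.
Qed.

(** * Counting V_{s,i} *)

(** The matrix is the Gram matrix of the rows of [row_mx p.1 p.2] for the standard symplectic form,
    which has no radical. *)
Lemma card_zero_bivectors (K : finFieldType) M i :
  #|[set p : 'M[K]_(M, i) * 'M[K]_(M, i) | p.1 *m p.2^T - p.2 *m p.1^T == 0]|
  = isotropic_count #|K| M i.
Proof.
pose J : 'M[K]_(i + i) := block_mx 0 1%:M (- 1%:M) 0.
have form m' (A B : 'M[K]_(m', i)) :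
    row_mx A B *m J *m (row_mx A B)^T = A *m B^T - B *m A^T.
  rewrite mul_row_block tr_row_mx mul_row_col !mulmx0 !mulmxN !mulmx1 add0r addr0.
  by rewrite mulNmx addrC.
have altJ : alternating_mx K (i + i) J.
  split=> [|u]; last first.
    rewrite -[u]hsubmxK form; apply/matrixP => a b; rewrite !ord1 !mxE.
    by apply/eqP; rewrite subr_eq0; apply/eqP/eq_bigr => l _; rewrite !mxE mulrC.
  rewrite tr_block_mx opp_block_mx !trmx0 !oppr0 opprK trmx1.
  by rewrite raddfN /= trmx1.
have rJ : \rank J = (2 * i)%N.
  rewrite mul2n -addnn; apply: mxrank_unit.
  suff : J *m - J = 1%:M by case/mulmx1_unit.
  rewrite mulmxN mulmx_block !mulmx0 !mul0mx !mulmx1 !mul1mx addr0 !add0r addr0.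
  by rewrite opp_block_mx !oppr0 opprK -scalar_mx_block.
have := card_isotropic K M (i + i) i J altJ rJ.
rewrite mul2n -addnn subnn muln0 expn0 mul1n => <-.
pose f (p : 'M[K]_(M, i) * 'M[K]_(M, i)) := row_mx p.1 p.2.
have f_inj : injective f by move=> [A B] [A' B'] /eq_row_mx /= [-> ->].
rewrite -(card_imset _ f_inj); apply: eq_card => A; rewrite inE.
apply/imsetP/idP => [[p + ->]|isoA]; first by rewrite inE /f form.
exists (lsubmx A, rsubmx A); last by rewrite /f hsubmxK.
by rewrite inE -form hsubmxK.
Qed.

Lemma coordE (F : finFieldType) N (x : {ffun 'I_N -> F}) (o : 'I_N) (k : nat) :
  k = o -> Defs.coord x k = x o.
Proof. by move=> ->; rewrite /Defs.coord valK. Qed.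

(** Modulo the period [2 * n'], [-j] is [j * (2 * n' - 1)], which turns the possibly negative
    exponent into a natural number. *)
Lemma frobz_iter (F : finFieldType) m d e n' j (z : F) :
  #|F| = (2 ^ m)%N -> (0 < m)%N -> m = (e * (2 * n'))%N -> (e %| d)%N -> (0 < n')%N ->
  frobz m ((n'%:Z - j%:Z) * d%:Z) z = frob_iter F d (n' + j * (2 * n').-1) z.
Proof.
move=> cardF m0 defm /dvdnP[d' defd] n0.
rewrite /frobz /frob_iter -[RHS](expf_frob_mod _ m) //; congr (_ ^+ (2 ^ _)).
have -> : (n'%:Z - j%:Z) * d%:Z
          = (- (j * d')%:Z) * m%:Z + (d * (n' + j * (2 * n').-1))%:Z.
  by rewrite defm defd; nia.
by rewrite modzMDl modz_nat absz_nat.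
Qed.

Lemma half_ord_lt i (o : 'I_(2 * i)) : (o./2 < i)%N.
Proof. by have := ltn_ord o; lia. Qed.

Definition interleave (F : finFieldType) i (p : 'rV[F]_i * 'rV[F]_i) :
  {ffun 'I_(2 * i) -> F} :=
  [ffun o : 'I_(2 * i) =>
     (if odd o then p.2 else p.1) 0 (Ordinal (half_ord_lt i o))].

Lemma coord_interleave (F : finFieldType) i (p : 'rV[F]_i * 'rV[F]_i) (l : 'I_i) :
  (Defs.coord (interleave F i p) (2 * l) = p.1 0 l)
  * (Defs.coord (interleave F i p) (2 * l + 1) = p.2 0 l).
Proof.
have lt0 : (2 * l < 2 * i)%N by have := ltn_ord l; lia.
have lt1 : (2 * l + 1 < 2 * i)%N by have := ltn_ord l; lia.
split.
  rewrite (coordE F _ (interleave F i p) (Ordinal lt0)) // ffunE /=.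
  have -> : odd (2 * l) = false by lia.
  by congr (p.1 0 _); apply: val_inj => /=; lia.
rewrite (coordE F _ (interleave F i p) (Ordinal lt1)) // ffunE /=.
have -> : odd (2 * l + 1) = true by lia.
by congr (p.2 0 _); apply: val_inj => /=; lia.
Qed.

Lemma interleave_inj (F : finFieldType) i : injective (interleave F i).
Proof.
move=> p p' eq_pp'; rewrite [p]surjective_pairing [p']surjective_pairing.
congr (_, _); apply/rowP => l.
  by rewrite -!(coord_interleave F i _ l).1 eq_pp'.
by rewrite -!(coord_interleave F i _ l).2 eq_pp'.
Qed.

(** Dividing by [e] makes [d / e] invertible modulo [M = m / e]. *)
Lemma gcd_cofactor_inj e d m M (a b : 'I_M) :
  (0 < e)%N -> m = (e * M)%N -> e = gcdn m d -> d * a = d * b %[mod m] -> a = b.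
Proof.
move=> e0 defm eg; wlog le_ba : a b / (b <= a)%N => [th|].
  by have [/th|/ltnW/th th' /esym] := leqP b a; [apply | move/th'->].
have /dvdnP[d' defd] : (e %| d)%N by rewrite eg dvdn_gcdr.
have cop : coprime M d'.
  by rewrite /coprime -(eqn_pmul2l e0) muln1 muln_gcdr -defm mulnC -defd -eg.
move/eqP; rewrite eqn_mod_dvd ?leq_mul2l ?le_ba ?orbT // -mulnBr defm defd.
rewrite [(d' * e)%N]mulnC -mulnA dvdn_pmul2l // Gauss_dvdr // => dvd_ab.
apply: val_inj; apply/eqP; rewrite eqn_leq le_ba andbT -subn_eq0.
by apply: contraTT dvd_ab => ab; rewrite gtnNdvd ?lt0n //; have := ltn_ord a; lia.
Qed.

(** In coordinates over the fixed field, a point is a pair of [M] by [i] matrices, and it lies in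
    [Vset] exactly when its bivector is zero. *)
Lemma card_Vset (F : finFieldType) m n d e s i :
  #|F| = (2 ^ m)%N -> (0 < n)%N -> (0 < d)%N -> m = (2 * n)%N ->
  e = gcdn n d -> e = gcdn m d -> (i <= s)%N ->
  #|Vset F m n d e s i| = isotropic_count (2 ^ e) (2 * (n %/ e)) i.
Proof.
move=> cardF n0 d0 m2n eg egm le_is.
have e0 : (0 < e)%N by rewrite eg gcdn_gt0 n0.
have edn : (e %| n)%N by rewrite eg dvdn_gcdl.
have edd : (e %| d)%N by rewrite eg dvdn_gcdr.
set n' := (n %/ e)%N; have defn : n = (n' * e)%N by rewrite divnK.
have n'0 : (0 < n')%N by rewrite divn_gt0 // dvdn_leq.
have defm : m = (e * (2 * n'))%N by rewrite m2n defn; lia.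
have m0 : (0 < m)%N by rewrite m2n muln_gt0 n0.
set M := (2 * n')%N in defm *; have M0 : (0 < M)%N by rewrite muln_gt0.
have char2 : 2%N \in [pchar F] by apply: (card_finPcharP cardF).
have per z : frob_iter F d M z = z.
  rewrite /frob_iter -(expf_frob_mod _ m) //.
  have -> : ((d * M) %% m = 0)%N.
    by have /dvdnP[d' ->] := edd; rewrite -mulnA -defm modnMl.
  by rewrite expn0 expr1.
pose K : finFieldType := frob_subfield F char2 e.
have cardK : #|K| = (2 ^ e)%N.
  by apply: (card_frob_subfield F char2 e M e0); rewrite -defm.
pose phi : {rmorphism K -> F} := val.
have fixed c k : frob_iter F d k (phi c) = phi c.
  have /dvdnP[d' ->] := edd; rewrite /frob_iter mulnAC -mulnC.
  have /eqP fixc : phi c ^+ (2 ^ e) == phi c := valP c.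
  elim: (d' * k)%N => [|u IHu]; first by rewrite muln0 expn0 expr1.
  by rewrite mulnS expnD exprM fixc.
have cardFK : #|F| = (#|K| ^ M)%N by rewrite cardF cardK -expnM -defm.
have [eb eb_free] : exists eb : 'rV[F]_M,
    forall c : 'cV[K]_M, eb *m map_mx phi c = 0 -> c = 0.
  by apply: exists_frob_basis; rewrite cardFK.
have lin_inj r : injective (fun c : 'M[K]_(M, r) => eb *m map_mx phi c).
  move=> c c' eq_cc'; apply/eqP; rewrite -subr_eq0; apply/eqP/matrixP => p q.
  have : col q (c - c') = 0.
    by apply: eb_free; rewrite map_col colE mulmxA map_mxB mulmxBr eq_cc' subrr mul0mx.
  by move/matrixP/(_ p 0); rewrite !mxE.
have coords z : exists c : 'cV[K]_M, z = (eb *m map_mx phi c) 0 0.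
  have inj1 : injective (fun c : 'cV[K]_M => (eb *m map_mx phi c) 0 0).
    by move=> c c' eq_cc'; apply: lin_inj; apply/matrixP=> p q; rewrite !ord1.
  have [|f _ can] := inj_card_bij inj1; first by rewrite card_mx muln1 cardFK.
  by exists (f z); rewrite can.
(* This Moore matrix is invertible: a relation between its rows would be a relation between the maps
   [tau^a] on all of [F]. *)
pose E := \matrix_(a < M, p < M) frob_iter F d a (eb 0 p).
have freeE : row_free E.
  apply: inj_row_free => v vE; apply/rowP => a; rewrite mxE.
  apply: (frob_iter_indep F m d M (v 0) cardF m0) => [a' b'|z].
    exact: (gcd_cofactor_inj e d m M a' b' e0 defm egm).
  have [c ->] := coords z; transitivity ((v *m E *m map_mx phi c) 0 0); last first.
    by rewrite vE mul0mx mxE.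
  rewrite -mulmxA [RHS]mxE; apply: eq_bigr => a' _; congr (_ * _).
  rewrite [in LHS]mxE frob_iter_sum // [RHS]mxE; apply: eq_bigr => p _.
  by rewrite frob_iterM !mxE fixed.
pose g (p : 'M[K]_(M, i) * 'M[K]_(M, i)) :=
  interleave F i (eb *m map_mx phi p.1, eb *m map_mx phi p.2).
have g_inj : injective g.
  move=> [X Y] [X' Y'] /interleave_inj /= eq_XY.
  by congr (_, _); apply: lin_inj; [case: eq_XY | case: eq_XY].
have [|g' _ gK] := inj_card_bij g_inj.
  rewrite card_prod !card_mx card_ffun card_ord cardFK -!expnM -expnD.
  by rewrite leq_exp2l ?finNzRing_gt1 //; lia.
have mem_V p : (g p \in Vset F m n d e s i) = [forall j : 'I_s.+1,
    twisted_form F d i (eb *m map_mx phi p.1) (eb *m map_mx phi p.2)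
      0 (n' + j * M.-1) == 0].
  rewrite inE; apply: eq_forallb => j; congr (_ == 0); apply: eq_bigr => l _.
  rewrite !coord_interleave !(frobz_iter F m d e n' _ _ cardF m0 defm edd n'0).
  by rewrite /frob_iter !muln0 !expn0 !expr1.
rewrite -cardK -card_zero_bivectors -(card_imset _ g_inj); apply: eq_card => w.
rewrite -[w]gK mem_V (mem_imset _ _ g_inj) inE; set p := g' w.
have form := twisted_form_coord K F phi d M i eb p.1 p.2 _ _ char2 fixed.
apply/forallP/eqP => [allj|S0 j]; last by rewrite form S0 raddf0 mulmx0 mul0mx mxE.
set x := eb *m map_mx phi p.1 in allj form; set y := eb *m _ in allj form.
have known u : (u <= s)%N -> twisted_form F d i x y 0 (n' + u * M.-1) = 0.
  by move=> us; apply/eqP/(allj (Ordinal (us : u < s.+1)%N)).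
have zero0 : forall k, twisted_form F d i x y 0 k = 0.
  (* The run starts at index [n' - s] modulo [M], and [i <= s] keeps its [2i] terms at or below
     [n' + s]. *)
  apply: (twisted_form_vanish F d M i x y (n' + s * M.-1) char2 M0 per) => t lt_t.
  have [le_ts|lt_st] := leqP t s.
    rewrite -(known (s - t)%N (leq_subr _ _)).
    rewrite -[RHS](twisted_form_period F d M _ _ _ _ _ t) //.
    congr (twisted_form F d i x y 0 _); case: (M) M0 => // M' _ /=.
    by rewrite -{1}(subnKC le_ts) mulSn; ring.
  (* Past the middle, the index is [n' + u] with [u = t - s]. Since [M = 2n'], symmetry and a shift
     by [n' + u] relate it to the known index [n' - u]. *)
  have -> : (n' + s * M.-1 + t = M * s + (n' + (t - s)))%N.
    by case: (M) M0 => // M' _ /=; rewrite -{1}(subnKC (ltnW lt_st)) mulSn; ring.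
  have le_u : (t - s <= s)%N by lia.
  move: (t - s)%N le_u => u le_u; rewrite twisted_form_period // twisted_form_sym.
  rewrite -[RHS](frob_iter0 F d (n' + u)) -(known u le_u) -twisted_form_shift // addn0.
  rewrite -[LHS](twisted_form_period F d M _ _ _ _ _ u.+1) // addn0.
  congr (twisted_form F d i x y _ _).
  have -> : (n' + u + (n' + u * M.-1) = M + u * M.-1.+1)%N.
    by rewrite /M; ring.
  by rewrite prednK // mulnC mulSn.
have zero a b : twisted_form F d i x y a b = 0.
  wlog le_ab : a b / (a <= b)%N => [th|].
    by have [/th //|/ltnW/th] := leqP a b; rewrite twisted_form_sym.
  by rewrite -(subnKC le_ab) -{1}[a]addn0 twisted_form_shift // zero0 frob_iter0.
set S := _ - _ in form *.
have ESE : E *m map_mx phi S *m E^T = 0.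
  apply/matrixP => a b; rewrite [RHS]mxE -(zero a b) form !mxE.
  apply: eq_bigr => q _; rewrite !mxE; congr (_ * _).
  by apply: eq_bigr => r _; rewrite !mxE.
have unitE : E \in unitmx by rewrite -row_free_unit.
have unitET : E^T \in unitmx by rewrite unitmx_tr.
apply/eqP; rewrite -(map_mx_eq0 phi); apply/eqP.
by rewrite -(mulKmx unitE (map_mx phi S)) -(mulmxK unitET (E *m _)) ESE mul0mx mulmx0.
Qed.

Theorem theorem7p2 (F : finFieldType) (m n d e s v : nat) :
  #|F| = (2 ^ m)%N ->
  (0 < m)%N -> (0 < n)%N -> (0 < d)%N -> (0 < e)%N ->
  m = (2 * n)%N -> e = gcdn n d -> e = gcdn m d ->
  (1 <= v)%N -> (v <= s)%N ->
  \sum_(i < v.+1)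
     ((-1) ^+ (v - i) * (4%:Q ^+ (e * 'C(v - i, 2))) * gbinom (4%:Q ^+ e) v i
      * (2%:Q ^- (m * i)) * (#|Vset F m n d e s i|)%:R)
  = 2%:Q ^ ((e%:Z - m%:Z) * v%:Z) * \prod_(j < v) (2%:Q ^+ m - 4%:Q ^+ (e * j)).
Proof.
move=> cardF m0 n0 d0 e0 m2n en em v1 vs.
have q1 : (1 < 2 ^ e)%N by rewrite -{1}(expn0 2) ltn_exp2l.
have edn : (e %| n)%N by rewrite en dvdn_gcdl.
have QE : (2 ^ e)%:R ^+ 2 = 4%:Q ^+ e :> rat by rewrite natrX -exprM mulnC exprM.
have defm : m = (e * (2 * (n %/ e)))%N by rewrite mulnCA [(e * _)%N]mulnC divnK.
(* With [q = 2^e] and [M = 2n/e], [q^2 = 4^e] and [q^M = 2^m]. *)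
transitivity (gauss_moment (2 ^ e) (2 * (n %/ e)) v).
  apply: eq_bigr => i _; rewrite (card_Vset F m n d e s) //; last first.
    by rewrite (leq_trans _ vs) // -ltnS.
  rewrite /gauss_coef /isotropic_moment QE -exprM natrX -exprM mulnA -defm.
  by rewrite -mulrA [_ / _]mulrC.
rewrite gauss_moment_even // QE -exprM.
have -> : 4%:Q ^+ (e * (n %/ e)) = 2%:Q ^+ m.
  by rewrite mulnC divnK // m2n exprM.
have X0 : 2%:Q ^+ m != 0 by rewrite expf_neq0.
(* Extracting [2^m] from each factor cancels the [2^(-mv)] of the prefactor and leaves [q^v]. *)
have -> : \prod_(j < v) (2%:Q ^+ m - 4%:Q ^+ (e * j))
          = (2%:Q ^+ m) ^+ v * \prod_(j < v) (1 - 4%:Q ^+ e ^+ j / 2%:Q ^+ m).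
  transitivity (\prod_(j < v) (2%:Q ^+ m * (1 - 4%:Q ^+ e ^+ j / 2%:Q ^+ m))).
    by apply: eq_bigr => j _; rewrite mulrBr mulr1 mulrCA divff // mulr1 exprM.
  by rewrite big_split /= prodr_const card_ord.
have -> : 2%:Q ^ ((e%:Z - m%:Z) * v%:Z) = (2%:Q ^+ e / 2%:Q ^+ m) ^+ v.
  by rewrite -exprz_exp expfzDr // -exprnN -!exprnP.
by rewrite mulrA -exprMn divfK // natrX.
Qed.
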